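(* Let $G=(V,E)$ be a locally finite connected weighted graph with measure $\mu\ge\mu_0>0$, let $p\ge2$, $h:V\to\mathbb{R}$, $F:V\times\mathbb{R}\to\mathbb{R}$, and $e\in L^{\frac{p}{p-1}}(V)$ with $e\not\equiv0$. Assume: (h1) there is a constant $h_0>0$ such that $h(x)\ge h_0$ for all $x\in V$; (h2) $h(x)\to\infty$ as $\mathrm{dist}(x,x_0)\to\infty$ for some fixed $x_0\in V$; (f0) $F(x,s)$ is continuously differentiable in $s\in\mathbb{R}$ for all $x\in V$, and there are a continuous function $a:[0,\infty)\to[0,\infty)$ and $b:V\to[0,\infty)$ with $b\in L^1(V)$ such that $|F_s(x,s)|\le a(|s|)b(x)$ and $|F(x,s)|\le a(|s|)b(x)$ for all $x\in V$, $s\in\mathbb{R}$; (f1) $F(x,0)=0$ for all $x\in V$, and there are $f_1,g_1:V\to[0,\infty)$ with $f_1\in L^\infty(V)$, $g_1\in L^{\frac{p}{p-1}}(V)$ and $\|f_1\|_\infty<h_0$ such that $|F_s(x,s)|\le f_1(x)|s|^{p-1}+g_1(x)$ for all $x\in V$, $s\in\mathbb{R}$; (f2) there are $\beta_1>1$ and $K_1:V\to\mathbb{R}$ such that $K_1(x_1)>0$ for some $x_1\in V$ with $e(x_1)>0$, and $F(x,s)\ge-K_1(x)|s|^{\beta_1}$ for all $x\in V$, $s\in\mathbb{R}$. Then for each $\epsilon\in(0,+\infty)$ the equation $$-\Delta_pu+h(x)|u|^{p-2}u=F_u(x,u)+\epsilon e(x),\qquad x\in V,$$ has at least one nontrivial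 solution $u\neq0$.
   Context: Graph setting: $G=(V,E)$ is locally finite (each vertex lies on finitely many edges) and connected; each edge $xy\in E$ has a weight $\omega_{xy}=\omega_{yx}>0$; $y\sim x$ means $xy\in E$; $\mathrm{dist}(x,y)$ is the minimal number of edges connecting $x$ and $y$; $\mu:V\to(0,\infty)$ satisfies $\mu(x)\ge\mu_0>0$ for all $x$. Write $\int_V u\,d\mu=\sum_{x\in V}u(x)\mu(x)$, $\|u\|_{L^r(V)}=(\int_V|u|^rd\mu)^{1/r}$, $\|u\|_\infty=\sup_V|u|$. For $u:V\to\mathbb{R}$: $|\nabla u|(x)=\left(\frac{1}{2\mu(x)}\sum_{y\sim x}\omega_{xy}(u(y)-u(x))^2\right)^{1/2}$ and, for $p\ge2$ (with $|\cdot|^0=1$ if $p=2$), $$\Delta_pu(x)=\frac{1}{2\mu(x)}\sum_{y\sim x}\left(|\nabla u|^{p-2}(y)+|\nabla u|^{p-2}(x)\right)\omega_{xy}(u(y)-u(x)).$$ $C_c(V)$ is the set of finitely supported functions on $V$; $W^{1,p}(V)$ is the completion of $C_c(V)$ under $\left(\int_V|\nabla u|^p+|u|^pd\mu\right)^{1/p}$ (a space of functions on $V$), and $W_h^{1,p}(V)=\{u\in W^{1,p}(V):\int_Vh|u|^pd\mu<\infty\}$ with norm $\left(\int_V|\nabla u|^p+h|u|^pd\mu\right)^{1/p}$. A solution is a function $u\in W_h^{1,p}(V)$ satisfying the equation at every $x\in V$. $F_u$ (also $F_s$) is the partial derivative of $F$ in its second variable. *)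

(* Defs.v *)
From HB Require Import structures.
From mathcomp Require Import all_boot all_order all_algebra.
From mathcomp Require Import all_classical all_reals all_analysis.
Import Order.TTheory GRing.Theory Num.Theory.
Import numFieldNormedType.Exports.

Set Implicit Arguments.
Unset Strict Implicit.
Unset Printing Implicit Defensive.

Local Open Scope classical_set_scope.
Local Open Scope ring_scope.

(* Only the values [wt x y] with [adj x y] are meaningful.  Loops are not
   excluded: they contribute [u x - u x = 0] to every operator below. *)
Record wgraph (R : realType) (V : choiceType) := WGraph {
  adj : rel V ;
  wt : V -> V -> R ;
  adj_sym : symmetric adj ;
  wt_sym : forall x y, adj x y -> wt x y = wt y x ;
  wt_gt0 : forall x y, adj x y -> 0 < wt x y ;
  locally_finite : forall x, finite_set [set y | adj x y] ;
  graph_connected : forall x y, exists s : seq V, path adj x s /\ last x s = y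
}.

Section graph_calculus.
Context {R : realType} {V : choiceType}.
Implicit Types (G : wgraph R V) (mu h u : V -> R) (p r : R).

Definition has_walk G (x y : V) : pred nat :=
  fun n => `[< exists s : seq V, [/\ path (adj G) x s, last x s = y & size s = n] >].

Lemma has_walk_ex G x y : exists n, has_walk G x y n.
Proof.
by have [s [ps ls]] := graph_connected G x y; exists (size s); apply/asboolP; exists s.
Qed.

Definition dist G (x y : V) : nat := ex_minn (has_walk_ex G x y).

(* [esum] is a supremum of finite partial sums, hence the integral is meant for
   nonnegative [u] only. *)
Definition integralV mu u : \bar R := \esum_(x in [set: V]) (u x * mu x)%:E.

Definition LnormV mu r u : \bar R :=
  (integralV mu (fun x => (`|u x| `^ r)%R) `^ r^-1)%E.

Definition in_LV mu r u : Prop := (LnormV mu r u < +oo)%E.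

Definition supnormV u : \bar R := ereal_sup (range (fun x => `|u x|%:E)).

Definition in_LinftyV u : Prop := (supnormV u < +oo)%E.

Definition grad G mu u (x : V) : R :=
  Num.sqrt ((2 * mu x)^-1 *
    \sum_(y \in [set y | adj G x y]) wt G x y * (u y - u x) ^+ 2).

(* [0 `^ 0 = 1], so that the weights are 1 when [p = 2]. *)
Definition plaplacian G mu p u (x : V) : R :=
  (2 * mu x)^-1 *
    \sum_(y \in [set y | adj G x y])
      (grad G mu u y `^ (p - 2) + grad G mu u x `^ (p - 2)) *
      wt G x y * (u y - u x).

Definition W1p_norm G mu p u : \bar R :=
  (integralV mu (fun x => (grad G mu u x `^ p + `|u x| `^ p)%R) `^ p^-1)%E.

Definition finitely_supported u : Prop := finite_set [set x | u x != 0].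

(* The completion of the finitely supported functions, realized as their closure
   for the [W1p_norm] among all functions on [V]: when [mu] is bounded below by a
   positive constant, norm-Cauchy sequences converge pointwise and in norm. *)
Definition W1p G mu p u : Prop :=
  exists v : nat -> V -> R,
    (forall n, finitely_supported (v n)) /\
    W1p_norm G mu p (fun x => v n x - u x) @[n --> \oo] --> 0%E.

Definition W1ph G mu h p u : Prop :=
  W1p G mu p u /\ (integralV mu (fun x => (h x * `|u x| `^ p)%R) < +oo)%E.

End graph_calculus.

(* Main.v *)
Require Import Defs.
From HB Require Import structures.
From mathcomp Require Import all_boot all_order all_algebra.
From mathcomp Require Import all_classical all_reals all_analysis.
From mathcomp Require Import finmap ring lra.
Import Order.TTheory GRing.Theory Num.Theory.
Import numFieldNormedType.Exports.

Set Implicit Arguments.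
Unset Strict Implicit.
Unset Printing Implicit Defensive.

Local Open Scope classical_set_scope.
Local Open Scope ring_scope.

(* Minimize J(u) = 1/p int (|grad u|^p + h |u|^p) - int (F(x, u) + eps e u) over
   the finitely supported u. By (f1) and Young's inequality J + C dominates a
   multiple of the energy int (|grad u|^p + h |u|^p); a minimizing sequence is
   thus bounded in energy, hence uniformly bounded because h >= h0 and
   mu >= mu0, and it converges pointwise along an ultrafilter. Clarkson's
   inequality for p >= 2, together with the domination of F(x, .) by b in L^1 on
   bounded ranges, makes the sequence Cauchy in energy, so that the limit u lies
   in W_h^{1,p}. Perturbing at one vertex changes J by a finite sum, so the
   minimality of u against such perturbations passes to the limit and is the
   equation at that vertex. Finally 0 is not a solution: as beta1 > 1, (f2)
   forces F_s(x1, 0) = 0, whereas e(x1) > 0. *)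

(** * Real powers *)

Section powR_inequalities.
Context {R : realType}.
Implicit Types a b s t q r : R.

(** Young's inequality for [b] and [a ^ (q - 1)], with exponents [q] and [q / (q - 1)], gives the
    tangent inequality without any derivative, so [a = 0] is allowed. The case [q = 1], where the
    conjugate exponent degenerates, is treated apart. *)
Lemma powR_tangent q a b : 1 <= q -> 0 <= a -> 0 <= b ->
  a `^ q - b `^ q <= q * a `^ (q - 1) * (a - b).
Proof.
rewrite le_eqVlt => /predU1P[<-|q1] a0 b0.
  by rewrite subrr powRr0 !powRr1// !mul1r.
have q0 : 0 < q by apply: lt_trans q1.
have q10 : 0 < q - 1 by rewrite subr_gt0.
have cq0 : 0 < q / (q - 1) by rewrite divr_gt0.
have cq : q^-1 + (q / (q - 1))^-1 = 1 by rewrite invf_div; field; rewrite gt_eqF.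
have := @conjugate_powR _ b (a `^ (q - 1)) q (q / (q - 1)) b0 (powR_ge0 _ _) q0 cq0 cq.
rewrite -powRrM mulrCA divff ?gt_eqF// mulr1 => young.
have aq : a * a `^ (q - 1) = a `^ q by rewrite mulr_powRB1.
have : q * (b * a `^ (q - 1)) <= q * (b `^ q / q + a `^ q / (q / (q - 1))).
  by rewrite ler_pM2l.
have -> : q * (b `^ q / q + a `^ q / (q / (q - 1))) = b `^ q + (q - 1) * a `^ q.
  by field; rewrite !gt_eqF.
by rewrite -aq; lra.
Qed.

Lemma powR_superadditive q a b : 1 <= q -> 0 <= a -> 0 <= b ->
  a `^ q + b `^ q <= (a + b) `^ q.
Proof.
move=> q1 a0 b0; have q0 : 0 < q by apply: lt_le_trans q1.
rewrite -(mulr_powRB1 a0 q0) -(mulr_powRB1 b0 q0) -(mulr_powRB1 (addr_ge0 a0 b0) q0).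
rewrite mulrDl lerD// ler_wpM2l// ge0_ler_powR ?subr_ge0// ?nnegrE ?addr_ge0//.
  by rewrite lerDl.
by rewrite lerDr.
Qed.

(** Add the tangent inequalities at the midpoint: the linear terms cancel. *)
Lemma powR_midpoint q a b : 1 <= q -> 0 <= a -> 0 <= b ->
  ((a + b) / 2) `^ q <= (a `^ q + b `^ q) / 2.
Proof.
move=> q1 a0 b0; have c0 : 0 <= (a + b) / 2 by rewrite divr_ge0 ?addr_ge0.
have := lerD (powR_tangent q1 c0 a0) (powR_tangent q1 c0 b0).
rewrite -mulrDr (_ : _ - a + _ = 0) ?mulr0; last by field.
lra.
Qed.

(** Scalar core of Clarkson's inequality: with [q = p / 2] and squared quantities as arguments, the
    hypothesis on [s + t] is the parallelogram law. *)
Lemma powR_clarkson q a b s t : 1 <= q -> 0 <= a -> 0 <= b -> 0 <= s -> 0 <= t ->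
  s + t = (a + b) / 2 -> s `^ q + t `^ q <= (a `^ q + b `^ q) / 2.
Proof.
move=> q1 a0 b0 s0 t0 st; apply: le_trans (powR_midpoint q1 a0 b0).
by rewrite -st powR_superadditive.
Qed.

Lemma young_powR_eps p d : 1 < p -> 0 < d -> exists2 C : R, 0 <= C &
  forall a b, 0 <= a -> 0 <= b -> a * b <= d * a `^ p + C * b `^ (p / (p - 1)).
Proof.
move=> p1 d0; have p10 : 0 < p - 1 by rewrite subr_gt0.
have p0 : 0 < p by lra.
exists (d^-1 `^ (p - 1)^-1) => [|a b a0 b0]; first exact: powR_ge0.
(* Either the first term alone dominates, or [a] is below [(b / d) ^ (1 / (p - 1))], which yields
   the constant chosen above. *)
have [ba|ab] := leP b (d * a `^ (p - 1)).
  rewrite -[leLHS]addr0 lerD ?mulr_ge0 ?powR_ge0//.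
  by rewrite -(mulr_powRB1 a0 p0) mulrCA ler_wpM2l.
rewrite -[leLHS]add0r lerD ?mulr_ge0 ?powR_ge0 ?(ltW d0)//.
have -> : b `^ (p / (p - 1)) = b * b `^ (p - 1)^-1.
  rewrite -[X in _ * _ `^ X](_ : p / (p - 1) - 1 = _).
    by rewrite mulr_powRB1 ?divr_gt0.
  by field; rewrite gt_eqF.
rewrite mulrCA [leLHS]mulrC ler_wpM2l//.
rewrite -powRM ?invr_ge0 ?(ltW d0)//.
rewrite -[leLHS]powRr1// -[X in _ `^ X <= _](@mulfV _ (p - 1)) ?gt_eqF// powRrM.
rewrite ge0_ler_powR ?invr_ge0 ?nnegrE ?powR_ge0 ?mulr_ge0 ?invr_ge0 ?(ltW p10)
  ?(ltW d0)//.
by rewrite mulrC ler_pdivlMr// mulrC ltW.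
Qed.

(** Differentiability of the power settles only [l > 0]. For [r = 0] the function is constantly 1,
    also at 0, and for [l = 0] the bound is explicit. *)
Lemma cvg_powR (T : Type) (U : set_system T) (FU : Filter U) (f : T -> R) (l r : R) :
  0 <= r -> (forall x, 0 <= f x) -> 0 <= l -> f @ U --> l ->
  (fun x => f x `^ r) @ U --> l `^ r.
Proof.
rewrite le_eqVlt => /predU1P[<-|r0] f0 l0 fl.
  under eq_fun do rewrite powRr0; rewrite powRr0; exact: cvg_cst.
move: l0; rewrite le_eqVlt => /predU1P[l0|l0].
  rewrite -l0 powR0 ?gt_eqF//; apply/cvgr0Pnorm_lt => e e0.
  have e1 : 0 < e `^ r^-1 by rewrite powR_gt0.
  move: fl; rewrite -l0 => /cvgr0Pnorm_lt/(_ _ e1); apply: filterS => x.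
  rewrite !ger0_norm ?powR_ge0// => fx.
  rewrite -[ltRHS](_ : (e `^ r^-1) `^ r = _); last first.
    by rewrite -powRrM mulVf ?gt_eqF// powRr1// ltW.
  by rewrite gt0_ltr_powR ?nnegrE// ltW.
apply: (cvg_comp _ (fun x => x `^ r) fl).
suff : {for l, continuous (fun x => x `^ r)} by [].
apply/differentiable_continuous/derivable1_diffP/derivable_powR.
by rewrite in_itv/= l0.
Qed.

Lemma norm_powR_sqr (s r : R) : `|s| `^ r = (s ^+ 2) `^ (r / 2).
Proof.
by rewrite -sqrtr_sqr -powR12_sqrt ?sqr_ge0// -powRrM mulrC.
Qed.

Lemma continuous_norm_powR r : 0 <= r -> continuous (fun x : R => `|x| `^ r).
Proof. by move=> r0 x; apply: cvg_powR => //; exact: norm_continuous. Qed.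

Lemma derive1_growth_ge0 (f : R -> R) p c g : 1 < p ->
  (forall s, derivable f s 1) -> f 0 = 0 ->
  (forall s, 0 < s -> derive1 f s <= c * s `^ (p - 1) + g) ->
  forall s, 0 <= s -> f s <= c / p * s `^ p + g * s.
Proof.
move=> p1 df f0 f'le s s0.
have p0 : 0 < p by apply: lt_trans p1.
pose phi s := c / p * s `^ p + g * s - f s.
have dphi (x : R) : 0 < x -> is_derive x 1 phi (c * x `^ (p - 1) + g - derive1 f x).
  move=> x0; have := is_derive1_powR p x0; have : is_derive x 1 f (derive1 f x).
    by rewrite derive1E; exact/derivableP.
  move=> h1 h2; apply: is_derive_eq.
  by rewrite /GRing.scale/= mulr1 mulrA divfK ?gt_eqF//.
suff : phi 0 <= phi s.
  by rewrite /phi f0 powR0 ?gt_eqF// !mulr0 addr0 subrr subr_ge0.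
apply: (@ger0_derive1_ndecry _ phi 0) => // [x|x|].
- by rewrite in_itv/= andbT => x0; have [] := dphi _ x0.
- rewrite in_itv/= andbT => x0; rewrite derive1E.
  by have [_ ->] := dphi _ x0; rewrite subr_ge0 f'le.
(* Continuity up to the endpoint 0: on the half-line [s] may be replaced by its absolute value,
   whose power is continuous everywhere. *)
- apply: (@subspace_eq_continuous _ _ _ (fun s => c / p * `|s| `^ p + g * s - f s)).
    move=> x /set_mem/=; rewrite in_itv/= andbT => x0.
    by rewrite /from_subspace/phi/= ger0_norm.
  apply: continuous_subspaceT => x; apply: cvgB; last first.
    suff : {for x, continuous f} by [].
    exact/differentiable_continuous/derivable1_diffP.
  apply: cvgD; apply: cvgMr; last exact: cvg_id.
  exact/continuous_norm_powR/ltW.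
Qed.

Lemma derive1_growth (f : R -> R) p c g : 1 < p ->
  (forall s, derivable f s 1) -> f 0 = 0 ->
  (forall s, `|derive1 f s| <= c * `|s| `^ (p - 1) + g) ->
  forall s, f s <= c / p * `|s| `^ p + g * `|s|.
Proof.
move=> p1 df f0 f'le s; have [s0|s0] := leP 0 s.
  rewrite ger0_norm//; apply: derive1_growth_ge0 => // x x0.
  by apply: le_trans (ler_norm _) _; rewrite -[x in x `^ _]gtr0_norm.
rewrite -[s in f s]opprK ltr0_norm//.
have dfN (x : R) : is_derive x 1 (fun t => f (- t)) (- derive1 f (- x)).
  have : is_derive (- x) 1 f (derive1 f (- x)).
    by rewrite derive1E; exact/derivableP.
  move=> h1; apply: is_derive_eq.
  by rewrite /GRing.scale/= mulrN1.
apply: (@derive1_growth_ge0 (fun t => f (- t)) p c g p1).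
- by move=> x; have [] := dfN x.
- by rewrite oppr0.
- move=> x x0; rewrite derive1E; have [_ ->] := dfN x.
  apply: le_trans (ler_norm _) _; rewrite normrN -[x in x `^ _]gtr0_norm//.
  by rewrite -[X in X `^ _]normrN.
- by rewrite oppr_ge0 ltW.
Qed.

End powR_inequalities.

(** * Limits and sums over the vertices *)

Lemma ultra_fmap (T S : Type) (f : T -> S) (U : set_system T) :
  UltraFilter U -> UltraFilter (f @ U).
Proof.
move=> UU; split; first exact: fmap_proper_filter.
move=> G GF fUG; rewrite predeqE => A; split=> [GA|]; last exact: fUG.
have [//|UnA] := in_ultra_setVsetC (f @^-1` A) UU.
have : G (A `&` ~` A) by apply: filterI => //; exact: fUG.
by rewrite setICr => /filter_not_empty.
Qed.

Section limits.
Context {R : realType}.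

Lemma cvg_fsum (T I : Type) (U : set_system T) (FU : Filter U) (r : seq I)
    (f : I -> T -> R) (l : I -> R) :
  (forall i, f i @ U --> l i) ->
  (fun x => \sum_(i <- r) f i x) @ U --> \sum_(i <- r) l i.
Proof. by move=> fl; apply: cvg_big => //; exact: add_continuous. Qed.

(** Compactness of [[-C, C]] in ultrafilter form. One ultrafilter serves all vertices at once, which
    replaces a diagonal extraction. *)
Lemma ultra_bounded_cvg (T : Type) (U : set_system T) (f : T -> R) C :
  UltraFilter U -> (forall x, `|f x| <= C) -> exists l : R, f @ U --> l.
Proof.
move=> UU fC; have := @segment_compact R (- C) C.
rewrite compact_ultra => /(_ (f @ U) (ultra_fmap f UU))[|l [_ fl]]; last by exists l.
apply: (@filterS _ U _ setT _ _ filterT) => x _ /=; rewrite in_itv/= -ler_norml.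
exact: fC.
Qed.

(** The two one-sided limits have opposite signs. First-order conditions are extracted from
    inequalities in this form. *)
Lemma dnbhs_sign_cvg_eq0 (phi : R -> R) (l : R) :
  (forall t, 0 <= t * phi t) -> phi t @[t --> 0^'] --> l -> l = 0.
Proof.
move=> tphi phil; apply/eqP; rewrite eq_le; apply/andP; split.
  have /cvgr_to_le : phi t @[t --> 0^'-] --> l by exact: cvg_dnbhs_at_left phil.
  apply; near=> t; have t0 : t < 0 by [].
  by have := tphi t; rewrite nmulr_rge0.
have /cvgr_to_ge : phi t @[t --> 0^'+] --> l by exact: cvg_dnbhs_at_right phil.
apply; near=> t; have t0 : 0 < t by [].
by have := tphi t; rewrite pmulr_rge0.
Unshelve. all: end_near. Qed.

Lemma derivable_slope_cvg (f : R -> R) (a : R) : derivable f a 1 ->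
  (fun t => (f (a + t) - f a) / t) @ 0^' --> derive1 f a.
Proof.
move=> df; rewrite derive1E; apply: (cvg_trans _ df); apply: near_eq_cvg.
near=> t; by rewrite /GRing.scale/= mulr1 mulrC [t + a]addrC.
Unshelve. all: end_near. Qed.

End limits.

Section fsums.
Context {R : realType} {V : choiceType}.
Implicit Types (A B : {fset V}) (f mu u : V -> R).

Lemma ler_fsum_sub f A B : (forall x, 0 <= f x) -> (A `<=` B)%fset ->
  \sum_(x <- A) f x <= \sum_(x <- B) f x.
Proof.
move=> f0 AB; rewrite (big_fsetID _ (mem A) B)/= -[leLHS]addr0 lerD ?sumr_ge0//.
rewrite le_eqVlt; apply/orP; left; apply/eqP; apply: eq_fbigl => x.
rewrite !inE/=; apply/idP/andP => [xA|[]//]; split=> //.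
exact: (fsubsetP AB).
Qed.

Lemma fsum_eq0_sub f A B : (A `<=` B)%fset ->
  (forall x, x \notin A -> f x = 0) -> \sum_(x <- A) f x = \sum_(x <- B) f x.
Proof. by move=> AB f0; apply: big_fset_incl => // x _; exact: f0. Qed.

Lemma bounded_fsum_tail f C : (forall x, 0 <= f x) ->
  (forall A, \sum_(x <- A) f x <= C) ->
  forall e, 0 < e -> exists B, forall A, \sum_(x <- (A `\` B)%fset) f x <= e.
Proof.
move=> f0 fC e e0; pose E := [set \sum_(x <- A) f x | A in [set: {fset V}]].
have supE : has_sup E.
  split; first by exists (\sum_(x <- fset0) f x), fset0.
  by exists C => _ [A _ <-].
(* A finite set whose sum is within [e] of the supremum leaves at most [e] to any set disjoint from
   it. *)
have [_ [B _ <-] Be] := sup_adherent e0 supE.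
exists B => A; have : \sum_(x <- (A `|` B)%fset) f x <= sup E.
  by apply: ub_le_sup; [exact: supE.2|exists (A `|` B)%fset].
rewrite (big_fsetID _ (mem B) (A `|` B)%fset)/=.
have -> : [fset x in (A `|` B)%fset | x \in B]%fset = B.
  by apply/fsetP => x; rewrite !inE/=; case: (x \in B); rewrite ?orbT ?andbF.
have -> : [fset x in (A `|` B)%fset | x \notin B]%fset = (A `\` B)%fset.
  by apply/fsetP => x; rewrite !inE/=; case: (x \in B); rewrite ?orbF ?andbF ?andbT.
lra.
Qed.

Lemma integralV_fsum mu f A : (\sum_(x \in [set` A]) (f x * mu x)%:E)%E
  = (\sum_(x <- A) f x * mu x)%:E.
Proof. by rewrite fsbig_finite// set_fsetK sumEFin. Qed.

Lemma integralV_le mu f C :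
  (forall A, \sum_(x <- A) f x * mu x <= C) -> (integralV mu f <= C%:E)%E.
Proof.
move=> fC; apply: ge_ereal_sup => _ [A [finA _] <-].
by rewrite -(fset_setK finA) integralV_fsum lee_fin.
Qed.

Lemma integralV_fsum_le mu f A :
  ((\sum_(x <- A) f x * mu x)%:E <= integralV mu f)%E.
Proof.
apply: ereal_sup_ubound; exists [set` A]; first by split.
exact: integralV_fsum.
Qed.

Lemma integralV_lty mu f : (integralV mu f < +oo)%E ->
  exists C, forall A, \sum_(x <- A) f x * mu x <= C.
Proof.
move=> fy; exists (fine (integralV mu f)) => A.
rewrite -lee_fin fineK ?integralV_fsum_le// fin_numE -ltey fy andbT.
rewrite -ltNye; apply: lt_le_trans (integralV_fsum_le mu f fset0).
exact: ltNyr.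
Qed.

Lemma in_LV_bounded mu r u : 0 < r -> in_LV mu r u ->
  exists C, forall A, \sum_(x <- A) `|u x| `^ r * mu x <= C.
Proof.
move=> r0 /lty_poweRy uL; apply/integralV_lty/uL.
by rewrite invr_neq0// lt0r_neq0.
Qed.

End fsums.

(** * The energy density *)

Section graph_energy.
Context {R : realType} {V : choiceType}.
Variables (G : wgraph R V) (mu h : V -> R) (p : R).
Hypothesis mu_gt0 : forall x, 0 < mu x.
Hypothesis h_ge0 : forall x, 0 <= h x.
Hypothesis p_ge2 : 2 <= p.
Implicit Types (u v w d : V -> R) (x y : V) (A B : {fset V}).

Definition nbs x : {fset V} := fset_set [set y | adj G x y].

Lemma in_nbs x y : (y \in nbs x) = adj G x y.
Proof.
rewrite in_fset_set; last exact: locally_finite.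
by apply/idP/idP => [/set_mem//|xy]; apply: mem_set.
Qed.

(** The carre du champ form of the graph; its diagonal is the squared gradient length. *)
Definition grad_inner u v x :=
  (2 * mu x)^-1 * \sum_(y <- nbs x) wt G x y * ((u y - u x) * (v y - v x)).

Definition grad2 u x := grad_inner u u x.

(** Written as powers [p / 2 >= 1] of squares, to which the parallelogram law and [powR_clarkson]
    apply; [energyE] recovers the usual density. *)
Definition energy u x := grad2 u x `^ (p / 2) + h x * (u x ^+ 2) `^ (p / 2).

Lemma half_p_ge1 : 1 <= p / 2. Proof. by rewrite ler_pdivlMr// mul1r. Qed.

Lemma half_p_gt0 : 0 < p / 2. Proof. by rewrite (lt_le_trans _ half_p_ge1). Qed.

Lemma grad2_ge0 u x : 0 <= grad2 u x.
Proof.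
rewrite mulr_ge0 ?invr_ge0 ?mulr_ge0 ?(ltW (mu_gt0 x))// big_seq sumr_ge0// => y.
by rewrite in_nbs => xy; rewrite mulr_ge0 ?(ltW (wt_gt0 xy))// -expr2 sqr_ge0.
Qed.

Lemma gradE u x : grad G mu u x = Num.sqrt (grad2 u x).
Proof.
rewrite /grad fsbig_finite; last exact: locally_finite.
by congr (Num.sqrt (_ * _)); apply: eq_bigr => y _; rewrite expr2.
Qed.

Lemma grad_powR u x r : grad G mu u x `^ r = grad2 u x `^ (r / 2).
Proof. by rewrite gradE -powR12_sqrt ?grad2_ge0// -powRrM mulrC. Qed.

Lemma energyE u x : energy u x = grad G mu u x `^ p + h x * `|u x| `^ p.
Proof. by rewrite /energy grad_powR norm_powR_sqr. Qed.

Lemma energy_ge0 u x : 0 <= energy u x.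
Proof. by rewrite addr_ge0 ?mulr_ge0 ?powR_ge0. Qed.

Lemma grad2_parallelogram u v x :
  grad2 (fun y => (u y + v y) / 2) x + grad2 (fun y => (u y - v y) / 2) x
  = (grad2 u x + grad2 v x) / 2.
Proof.
rewrite /grad2 /grad_inner -!mulrDr -mulrA; congr (_ * _).
rewrite -!big_split/= mulr_suml; apply: eq_bigr => y _.
by field.
Qed.

Lemma grad2D u d (t : R) x :
  grad2 (fun y => u y + t * d y) x
  = grad2 u x + t * (2 * grad_inner u d x + t * grad2 d x).
Proof.
rewrite /grad2 /grad_inner.
rewrite (eq_bigr (fun y => wt G x y * ((u y - u x) * (u y - u x))
    + t * (2 * (wt G x y * ((u y - u x) * (d y - d x)))
           + t * (wt G x y * ((d y - d x) * (d y - d x)))))).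
  by rewrite big_split/= -mulr_sumr big_split/= -!mulr_sumr; ring.
by move=> y _; ring.
Qed.

Lemma grad2_half u x : grad2 (fun y => u y / 2) x = 4^-1 * grad2 u x.
Proof.
rewrite /grad2 /grad_inner mulrCA; congr (_ * _); rewrite mulr_sumr.
by apply: eq_bigr => y _; field.
Qed.

Lemma energy_half u x :
  energy (fun y => u y / 2) x = 4^-1 `^ (p / 2) * energy u x.
Proof.
rewrite /energy grad2_half exprMn [u x ^+ 2 * _]mulrC.
rewrite (_ : (2^-1) ^+ 2 = 4^-1 :> R); last by rewrite exprVn -natrX.
move: (grad2_ge0 u x) (sqr_ge0 (u x)).
move: (grad2 u x) (u x ^+ 2) => a b a0 b0.
by rewrite !powRM ?invr_ge0// mulrDr; congr (_ + _); rewrite mulrCA.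
Qed.

Lemma energy_clarkson u v x :
  energy (fun y => (u y + v y) / 2) x + energy (fun y => (u y - v y) / 2) x
  <= (energy u x + energy v x) / 2.
Proof.
have q1 := half_p_ge1.
have g := powR_clarkson q1 (grad2_ge0 u x) (grad2_ge0 v x) (grad2_ge0 _ x)
  (grad2_ge0 _ x) (grad2_parallelogram u v x).
have := @powR_clarkson _ _ (u x ^+ 2) (v x ^+ 2) (((u x + v x) / 2) ^+ 2)
  (((u x - v x) / 2) ^+ 2) q1 (sqr_ge0 _) (sqr_ge0 _) (sqr_ge0 _) (sqr_ge0 _).
have -> : ((u x + v x) / 2) ^+ 2 + ((u x - v x) / 2) ^+ 2
    = (u x ^+ 2 + v x ^+ 2) / 2 by field.
move=> /(_ erefl) /(ler_wpM2l (h_ge0 x)) k.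
rewrite /energy; lra.
Qed.

Lemma cvg_grad2 (T : Type) (U : set_system T) (FU : Filter U) (v : T -> V -> R) u x :
  (forall y, v ^~ y @ U --> u y) -> (fun n => grad2 (v n) x) @ U --> grad2 u x.
Proof.
move=> vu; apply: cvgMr; apply: cvg_fsum => y; apply: cvgMr.
by apply: cvgM; apply: cvgB; exact: vu.
Qed.

Lemma cvg_energy (T : Type) (U : set_system T) (FU : Filter U) (v : T -> V -> R) u x :
  (forall y, v ^~ y @ U --> u y) -> (fun n => energy (v n) x) @ U --> energy u x.
Proof.
move=> vu; have q0 := ltW half_p_gt0; apply: cvgD; last apply: cvgMr.
  apply: cvg_powR => // [n||]; [exact: grad2_ge0|exact: grad2_ge0|exact: cvg_grad2].
apply: cvg_powR => // [n||]; [exact: sqr_ge0|exact: sqr_ge0|].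
by under eq_fun do rewrite expr2; apply: cvgM; exact: vu.
Qed.

(* [u] and its gradient vanish off [A], so that sums over [A] of densities
   built from [u] are integrals over the whole graph. *)
Definition covered A u :=
  forall x, x \notin A -> u x = 0 /\ forall y, adj G x y -> u y = 0.

Lemma coveredS A B u : (A `<=` B)%fset -> covered A u -> covered B u.
Proof.
by move=> AB Au x xB; apply: Au; apply: contra xB; exact: (fsubsetP AB).
Qed.

Lemma covered_lin A u v (a b : R) : covered A u -> covered A v ->
  covered A (fun x => a * u x + b * v x).
Proof.
move=> Au Av x xA; have [ux uy] := Au _ xA; have [vx vy] := Av _ xA.
by split=> [|y xy]; rewrite ?ux ?vx ?uy ?vy// !mulr0 addr0.
Qed.

Lemma covered_finite A u : covered A u -> finitely_supported u.
Proof.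
move=> Au; apply: (sub_finite_set _ (finite_fset A)) => x/=.
by apply: contraR => /Au [->].
Qed.

Lemma grad2_covered A u x : covered A u -> x \notin A -> grad2 u x = 0.
Proof.
move=> Au xA; have [ux uy] := Au _ xA.
rewrite /grad2 /grad_inner big_seq big1 ?mulr0// => y.
by rewrite in_nbs => /uy ->; rewrite ux subrr !mulr0.
Qed.

Lemma energy_covered A u x : covered A u -> x \notin A -> energy u x = 0.
Proof.
move=> Au xA; rewrite /energy (grad2_covered Au xA) (Au _ xA).1.
by rewrite expr0n/= powR0 ?gt_eqF ?half_p_gt0// mulr0 addr0.
Qed.

Definition point_mass x y : R := (y == x)%:R.

Lemma covered_point_mass x : covered (x |` nbs x)%fset (point_mass x).
Proof.
move=> y; rewrite in_fset1U negb_or in_nbs => /andP[yx xy].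
rewrite /point_mass (negbTE yx); split=> // z yz; case: eqP => // zx.
by move: xy; rewrite (adj_sym G) -zx yz.
Qed.

End graph_energy.

(** * Minimization of the action *)

Section minimization.
Context {R : realType} {V : choiceType}.
Variables (G : wgraph R V) (mu h : V -> R) (p mu0 h0 : R).
Hypotheses (mu0_gt0 : 0 < mu0) (mu_ge : forall x, mu0 <= mu x).
Hypotheses (h0_gt0 : 0 < h0) (h_ge : forall x, h0 <= h x) (p_ge2 : 2 <= p).
Variables (W : V -> R -> R) (g : V -> R) (theta Cg : R).
Hypotheses (W0 : forall x, W x 0 = 0) (W_cont : forall x, continuous (W x)).
Hypotheses (theta_gt0 : 0 < theta) (theta_le : theta <= p^-1).
Hypothesis g_sum : forall A : {fset V}, \sum_(x <- A) g x * mu x <= Cg.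
Hypothesis W_le : forall x s,
  W x s <= (p^-1 - theta) * (h x * (s ^+ 2) `^ (p / 2)) + g x.
(* Only the midpoint convexity defect of [W] has to be dominated, which does not
   see a linear term. *)
Hypothesis W_mid : forall C : R, exists b : V -> R,
  [/\ (forall x, 0 <= b x),
      (exists Cb : R, forall A : {fset V}, \sum_(x <- A) b x * mu x <= Cb)
    & (forall x (s t : R), `|s| <= C -> `|t| <= C ->
        (W x s + W x t) / 2 - W x ((s + t) / 2) <= b x)].
Implicit Types (u v w : V -> R) (x y : V) (A B : {fset V}).

Local Notation energy := (energy G mu h p).
Local Notation covered := (covered G).

Let mu_gt0 x : 0 < mu x. Proof. exact: lt_le_trans (mu_ge x). Qed.
Let h_gt0 x : 0 < h x. Proof. exact: lt_le_trans (h_ge x). Qed.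
Let h_ge0 x : 0 <= h x. Proof. exact: ltW. Qed.
Let p_gt0 : 0 < p. Proof. exact: lt_le_trans p_ge2. Qed.
Let energy_pos u x : 0 <= energy u x. Proof. exact: energy_ge0. Qed.

(** The factor [mu x] is included, so that plain sums over a covering set are values of J. *)
Definition lagrangian u x := (energy u x / p - W x (u x)) * mu x.

Lemma lagrangian_covered A u x : covered A u -> x \notin A -> lagrangian u x = 0.
Proof.
move=> Au xA; rewrite /lagrangian (energy_covered _ _ _ Au xA)// (Au _ xA).1.
by rewrite W0 mul0r subrr mul0r.
Qed.

(** Both sums equal the sum over the union, because the density vanishes off either set. The action
    is thus well defined. *)
Lemma action_covered A B u : covered A u -> covered B u ->
  \sum_(x <- A) lagrangian u x = \sum_(x <- B) lagrangian u x.
Proof.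
move=> Au Bu; have l0 C x : covered C u -> x \notin C -> lagrangian u x = 0.
  exact: lagrangian_covered.
rewrite (@fsum_eq0_sub _ _ _ A (A `|` B)%fset) ?fsubsetUl//; last first.
  by move=> x; exact: l0.
by rewrite [RHS](@fsum_eq0_sub _ _ _ B (A `|` B)%fset) ?fsubsetUr// => x; exact: l0.
Qed.

(** Coercivity: [W_le] leaves a share [theta] of the [h] part, while the gradient part keeps its
    whole factor [p^-1 >= theta]. *)
Lemma lagrangian_ge u x : theta * energy u x * mu x - g x * mu x <= lagrangian u x.
Proof.
rewrite /lagrangian -mulrBl ler_wpM2r// ?(ltW (mu_gt0 x))//.
have := W_le x (u x); rewrite /energy.
have : 0 <= (p^-1 - theta) * grad2 G mu u x `^ (p / 2).
  by rewrite mulr_ge0 ?powR_ge0// subr_ge0.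
rewrite mulrC; lra.
Qed.

Lemma action_ge A u :
  theta * (\sum_(x <- A) energy u x * mu x) - Cg <= \sum_(x <- A) lagrangian u x.
Proof.
have : \sum_(x <- A) (theta * energy u x * mu x - g x * mu x)
    <= \sum_(x <- A) lagrangian u x by apply: ler_sum => x _; exact: lagrangian_ge.
rewrite sumrB (eq_bigr (fun x => theta * (energy u x * mu x))) => [|x _]; last first.
  by rewrite mulrA.
rewrite -mulr_sumr; have := g_sum A; lra.
Qed.

Lemma energy_sum_ge0 A u : 0 <= \sum_(x <- A) energy u x * mu x.
Proof. by apply: sumr_ge0 => x _; rewrite mulr_ge0// ltW. Qed.

Definition actions :=
  [set r | exists A u, covered A u /\ r = \sum_(x <- A) lagrangian u x].

Lemma has_inf_actions : has_inf actions.
Proof.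
split.
  exists (\sum_(x <- fset0) lagrangian (fun=> 0) x), fset0, (fun=> 0).
  by split.
exists (- Cg) => _ [A [u [_ ->]]].
apply: le_trans (action_ge A u).
by rewrite -[leLHS]add0r lerD2r mulr_ge0 ?energy_sum_ge0// ltW.
Qed.

Lemma inf_action_le A u : covered A u -> inf actions <= \sum_(x <- A) lagrangian u x.
Proof.
by move=> Au; apply: ge_inf; [exact: has_inf_actions.2|exists A, u].
Qed.

Lemma minimizing_sequence : exists (A : nat -> {fset V}) (u : nat -> V -> R),
  forall n, covered (A n) (u n) /\
    \sum_(x <- A n) lagrangian (u n) x <= inf actions + n.+1%:R^-1.
Proof.
suff /choice[f fP] : forall n : nat, exists Au : {fset V} * (V -> R),
    covered Au.1 Au.2 /\
    \sum_(x <- Au.1) lagrangian Au.2 x <= inf actions + n.+1%:R^-1.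
  by exists (fst \o f), (snd \o f).
move=> n; have n0 : 0 < n.+1%:R^-1 :> R by rewrite invr_gt0.
have [_ [A [u [Au ->]]] /ltW lt] := inf_adherent n0 has_inf_actions.
by exists (A, u).
Qed.

Lemma energy_bounded : exists C, forall A u, covered A u ->
  \sum_(x <- A) lagrangian u x <= inf actions + 1 ->
  forall B, \sum_(x <- B) energy u x * mu x <= C.
Proof.
exists (theta^-1 * (inf actions + 1 + Cg)) => A u Au uA B.
apply: (@le_trans _ _ (\sum_(x <- A) energy u x * mu x)).
  rewrite [leRHS](@fsum_eq0_sub _ _ _ A (A `|` B)%fset) ?fsubsetUl//; last first.
    by move=> x xA; rewrite (energy_covered _ _ _ Au xA)// mul0r.
  by apply: ler_fsum_sub => [x|]; [rewrite mulr_ge0// ltW|exact: fsubsetUr].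
rewrite ler_pdivlMl//; have := action_ge A u; lra.
Qed.

(** Already the energy at the single vertex [x] is at least [h0 * mu0] times the [p]-th power of the
    absolute value of [u x]. *)
Lemma energy_sup_bound u C : (forall B, \sum_(x <- B) energy u x * mu x <= C) ->
  forall x, `|u x| <= (C / (h0 * mu0)) `^ p^-1.
Proof.
move=> uC x; have := uC [fset x]%fset; rewrite big_seq_fset1 => xC.
rewrite -[leLHS]powRr1// -[X in _ `^ X <= _](@mulfV _ p) ?gt_eqF// powRrM.
apply: ge0_ler_powR; rewrite ?invr_ge0 ?nnegrE ?powR_ge0 ?(ltW p_gt0)//.
  rewrite divr_ge0 ?mulr_ge0 ?(ltW h0_gt0) ?(ltW mu0_gt0)//.
  by apply: le_trans xC; rewrite mulr_ge0// ltW.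
rewrite ler_pdivlMr ?mulr_gt0//; apply: le_trans xC.
rewrite mulrA ler_pM ?mulr_ge0 ?powR_ge0 ?(ltW h0_gt0) ?(ltW mu0_gt0)//.
rewrite energyE// mulrC -[leLHS]add0r lerD ?powR_ge0//.
by rewrite ler_wpM2r ?powR_ge0.
Qed.

(** Clarkson's inequality for the energy; inserting [W] leaves its midpoint convexity defect as an
    error term. *)
Lemma lagrangian_clarkson u v x :
  energy (fun y => (u y - v y) / 2) x / p * mu x <=
  (lagrangian u x + lagrangian v x) / 2 - lagrangian (fun y => (u y + v y) / 2) x
  + ((W x (u x) + W x (v x)) / 2 - W x ((u x + v x) / 2)) * mu x.
Proof.
have := @energy_clarkson _ _ G mu h p mu_gt0 h_ge0 p_ge2 u v x.
move=> /(ler_wpM2r (ltW (mulr_gt0 (_ : 0 < p^-1) (mu_gt0 x)))).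
rewrite invr_gt0 => /(_ p_gt0).
rewrite /lagrangian; lra.
Qed.

Lemma cvg_lagrangian (T : Type) (U : set_system T) (FU : Filter U)
    (v : T -> V -> R) u x :
  (forall y, v ^~ y @ U --> u y) ->
  (fun n => lagrangian (v n) x) @ U --> lagrangian u x.
Proof.
move=> vu; apply: cvgMl; apply: cvgB; first by apply: cvgMl; exact: cvg_energy.
by apply: (cvg_comp _ _ (vu x)); exact: W_cont.
Qed.

(** Off a finite set [B] the summable bound [b] leaves at most [e / 2]. On [B] both values and their
    midpoint are close to [u x], and continuity of [W x] makes the defect small. *)
Lemma defect_small (U : set_system nat) (FU : ProperFilter U) (v : nat -> V -> R)
    u C : (forall n x, `|v n x| <= C) -> (forall y, v ^~ y @ U --> u y) ->
  forall e, 0 < e -> exists2 S, U S & forall n m, S n -> S m -> forall A,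
  \sum_(x <- A) ((W x (v n x) + W x (v m x)) / 2 - W x ((v n x + v m x) / 2)) * mu x
    <= e.
Proof.
move=> vC vu e e0; have [b [b0 [Cb bCb] bW]] := W_mid C.
have e20 : 0 < e / 2 by rewrite divr_gt0.
have [|B Bb] := @bounded_fsum_tail _ _ (fun x => b x * mu x) Cb _ bCb _ e20.
  by move=> x; rewrite mulr_ge0// ltW.
pose K := \sum_(x <- B) mu x.
have K0 : 0 <= K by apply: sumr_ge0 => x _; exact: ltW.
(* The sum of [c * mu x] over [B] is then at most [e / 2]; adding 1 keeps the denominator positive
   when [B] is empty. *)
pose c := e / 2 / (K + 1).
have c0 : 0 < c by rewrite divr_gt0// ltr_wpDl.
have c20 : 0 < c / 2 by rewrite divr_gt0.
have r_ex x : exists r, 0 < r /\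
    forall s, `|u x - s| < r -> `|W x (u x) - W x s| < c / 2.
  have /cvgrPdist_lt/(_ _ c20) := @W_cont x (u x).
  by move=> /nbhs_ballP[r /= r0 rP]; exists r; split.
pose S := \bigcap_(x in [set` B]) [set n | `|u x - v n x| < projT1 (cid (r_ex x))].
exists S.
  apply: filter_bigI => x _; case: cid => r /= [r0 _].
  by have /cvgrPdist_lt/(_ _ r0) := vu x.
move=> n m Sn Sm A; rewrite (big_fsetID _ (mem B))/=.
rewrite [leRHS](splitr e) lerD//; last first.
  rewrite (_ : [fset x in A | x \notin B]%fset = (A `\` B)%fset); last first.
    by apply/fsetP => x; rewrite !inE/= andbC.
  apply: le_trans (Bb A); apply: ler_sum => x _.
  by rewrite ler_wpM2r ?bW// ltW.
apply: (@le_trans _ _ (\sum_(x <- B) c * mu x)); last first.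
  rewrite -mulr_sumr -/K /c mulrAC ler_pdivrMr ?ltr_wpDl// ler_wpM2l ?ltW//.
  by rewrite ltrDl.
apply: (@le_trans _ _ (\sum_(x <- [fset x in A | x \in B]%fset) c * mu x)); last first.
  apply: ler_fsum_sub => [x|]; first by rewrite mulr_ge0// ltW.
  by apply/fsubsetP => x; rewrite !inE/= => /andP[].
rewrite big_seq [leRHS]big_seq; apply: ler_sum => x; rewrite !inE/= => /andP[_ xB].
rewrite ler_wpM2r ?(ltW (mu_gt0 x))//.
have := Sn x xB; have := Sm x xB; rewrite /=; case: cid => r /= [r0 rP] mr nr.
have /rP : `|u x - (v n x + v m x) / 2| < r.
  rewrite (_ : _ - _ = (u x - v n x) / 2 + (u x - v m x) / 2); last by field.
  rewrite (le_lt_trans (ler_normD _ _))// !normrM (@ger0_norm _ 2^-1)//; lra.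
have := rP _ mr; have := rP _ nr; rewrite !ltr_norml; lra.
Qed.

(** The midpoint of [v n] and [v m] is itself a competitor, so its action is at least the infimum.
    Clarkson's inequality then bounds the energy of the half difference by the minimization errors
    plus the defect, and [m] is sent to the limit along [U]. *)
Lemma energy_cauchy (U : set_system nat) (UU : ProperFilter U)
    (A : nat -> {fset V}) (v : nat -> V -> R) u :
  \oo `<=` U -> (forall n, covered (A n) (v n) /\
    \sum_(x <- A n) lagrangian (v n) x <= inf actions + n.+1%:R^-1) ->
  (forall y, v ^~ y @ U --> u y) ->
  forall e, 0 < e -> U [set n | forall B,
    \sum_(x <- B) energy (fun y => v n y - u y) x * mu x <= e].
Proof.
move=> ooU vmin vu e e0.
have v1 n : \sum_(x <- A n) lagrangian (v n) x <= inf actions + 1.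
  apply: le_trans (vmin n).2 _; rewrite lerD2l invf_le1 ?ltr0n// ler1n.
  by [].
have [C CP] := energy_bounded.
have vC n x : `|v n x| <= (C / (h0 * mu0)) `^ p^-1.
  exact: energy_sup_bound (CP _ _ (vmin n).1 (v1 n)) x.
pose k := 4^-1 `^ (p / 2) : R.
have k0 : 0 < k by rewrite powR_gt0// invr_gt0.
(* Halving a function multiplies its energy by [k], and [2 * d = k / p * e]: one [d] is for the
   minimization errors, one for the defect. *)
pose d := e * k / p / 2.
have d0 : 0 < d by rewrite !divr_gt0// mulr_gt0.
have [S US SP] := defect_small _ vC vu d0.
have Ud : U [set n | n.+1%:R^-1 <= d].
  apply: ooU; have := @near_infty_natSinv_lt R (PosNum d0).
  by apply: filterS => n /ltW.
have Sd : U (S `&` [set n | n.+1%:R^-1 <= d]) by exact: filterI.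
apply: filterS (Sd) => n [Sn nd] B /=.
have main m : S m -> m.+1%:R^-1 <= d ->
    \sum_(x <- B) energy (fun y => (v n y - v m y) / 2) x / p * mu x <= 2 * d.
  (* [D] covers both functions, hence their midpoint, so all three sums over [D] are full
     actions. *)
  move=> Sm md; pose D := (A n `|` A m `|` B)%fset.
  have Dn : covered D (v n).
    by apply: coveredS (vmin n).1; rewrite /D -fsetUA fsubsetUl.
  have Dm : covered D (v m).
    by apply: coveredS (vmin m).1; rewrite /D fsetUAC fsubsetUr.
  have Dmid : covered D (fun y => (v n y + v m y) / 2).
    rewrite (_ : (fun y => _) = (fun y => 2^-1 * v n y + 2^-1 * v m y)).
      exact: covered_lin.
    by apply/funext => y; field.
  apply: (@le_trans _ _
      (\sum_(x <- D) energy (fun y => (v n y - v m y) / 2) x / p * mu x)).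
    apply: ler_fsum_sub; last exact: fsubsetUr.
    by move=> x; rewrite mulr_ge0 ?divr_ge0 ?(ltW p_gt0) ?(ltW (mu_gt0 x)).
  apply: le_trans (ler_sum _ _) _ => [x _|]; first exact: lagrangian_clarkson.
  rewrite big_split/= sumrB -mulr_suml big_split/=.
  have combine (ln lm lmid w i rn rm : R) : ln <= i + rn -> lm <= i + rm ->
      i <= lmid -> w <= d -> rn <= d -> rm <= d -> (ln + lm) / 2 - lmid + w <= 2 * d.
    lra.
  apply: (combine _ _ _ _ _ _ _ _ _ (inf_action_le Dmid) (SP n m Sn Sm D) nd md).
    by rewrite -(action_covered (vmin n).1 Dn) (vmin n).2.
  by rewrite -(action_covered (vmin m).1 Dm) (vmin m).2.
have : \sum_(x <- B) energy (fun y => (v n y - u y) / 2) x / p * mu x <= 2 * d.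
  have lim : (fun m => \sum_(x <- B) energy (fun y => (v n y - v m y) / 2) x / p * mu x)
      @ U --> \sum_(x <- B) energy (fun y => (v n y - u y) / 2) x / p * mu x.
    apply: cvg_fsum => x; apply: cvgMl; apply: cvgMl; apply: cvg_energy => // y.
    by apply: cvgMl; apply: cvgB; [exact: cvg_cst|exact: vu].
  apply: (cvgr_to_le lim); apply: (@filterS _ U _ _ _ _ Sd) => m [Sm md].
  exact: main.
rewrite (eq_bigr (fun x => k / p * (energy (fun y => v n y - u y) x * mu x))).
  rewrite -mulr_sumr => le2d.
  rewrite -(@ler_pM2l _ (k / p)) ?divr_gt0//; apply: le_trans le2d _.
  by rewrite /d le_eqVlt; apply/orP; left; apply/eqP; field; rewrite gt_eqF.
by move=> x _; rewrite (energy_half _ h p mu_gt0)// -/k; ring.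
Qed.

(** The energy density dominates [Num.min 1 h0] times the density of the Sobolev norm, so the norms
    are at most [n.+1%:R^-1]. *)
Lemma cvg_W1p_norm_energy (v : nat -> V -> R) u :
  (forall n B, \sum_(x <- B) energy (fun y => v n y - u y) x * mu x
     <= Num.min 1 h0 * n.+1%:R^-1 `^ p) ->
  W1p_norm G mu p (fun x => v n x - u x) @[n --> \oo] --> 0%E.
Proof.
move=> vu; have m0 : 0 < Num.min 1 h0 by rewrite lt_min ltr01.
have le n : (W1p_norm G mu p (fun x => v n x - u x)%R <= (n.+1%:R^-1)%:E)%E.
  have n0 : 0 <= n.+1%:R^-1 :> R by rewrite invr_ge0.
  rewrite -[X in (_ <= X%:E)%E]powRr1//.
  rewrite -[X in (_ <= (_ `^ X)%:E)%E](@mulfV _ p) ?gt_eqF// powRrM -poweR_EFin.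
  have le : (integralV mu (fun x => grad G mu (fun x => v n x - u x) x `^ p
      + `|v n x - u x| `^ p)%R <= (n.+1%:R^-1 `^ p)%:E)%E.
    apply: integralV_le => B.
    rewrite -(ler_pM2l m0); apply: le_trans (vu n B).
    rewrite mulr_sumr; apply: ler_sum => x _; rewrite mulrA.
    rewrite ler_wpM2r ?(ltW (mu_gt0 x))// energyE// mulrDr lerD//.
      by rewrite ler_piMl ?powR_ge0// ge_min lexx.
    by rewrite ler_wpM2r ?powR_ge0// ge_min h_ge orbT.
  apply: gt0_ler_poweR; [by rewrite invr_ge0 ltW| | |exact: le];
    rewrite in_itv/= leey andbT.
    apply: esum_ge0 => x _.
    by rewrite lee_fin mulr_ge0 ?addr_ge0 ?powR_ge0// ltW.
  by rewrite lee_fin powR_ge0.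
have near_le : \forall n \near \oo,
    (0 <= W1p_norm G mu p (fun x => v n x - u x)%R <= (harmonic n)%:E)%E.
  by near=> i; rewrite le andbT poweR_ge0.
apply: (squeeze_cvge near_le); first exact: cvg_cst.
apply: cvg_EFin; last exact: cvg_harmonic.
by near=> i.
Unshelve. all: end_near. Qed.

(* Changing [u] at the single vertex [x] changes the action by a finite sum over
   the closed neighborhood of [x]: minimality therefore survives a pointwise
   limit, along which the action itself need not converge. *)
Lemma local_minimizer : exists u, W1ph G mu h p u /\ forall x (t : R),
  0 <= \sum_(y <- (x |` nbs G x)%fset)
         (lagrangian (fun z => u z + t * point_mass x z) y - lagrangian u y).
Proof.
have [A [v vmin]] := minimizing_sequence.
have v1 n : \sum_(x <- A n) lagrangian (v n) x <= inf actions + 1.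
  apply: le_trans (vmin n).2 _; rewrite lerD2l invf_le1 ?ltr0n// ler1n.
  by [].
have [C CP] := energy_bounded.
have vE n B := CP _ _ (vmin n).1 (v1 n) B.
have [U [UU ooU]] := @ultraFilterLemma nat \oo _.
have /choice[u vu] y : exists l : R, v ^~ y @ U --> l.
  by apply: ultra_bounded_cvg => n; exact: energy_sup_bound (vE n) y.
exists u; split; [split|].
- have m0 : 0 < Num.min 1 h0 by rewrite lt_min ltr01.
  (* The ultrafilter limit is turned into a sequence: for each [n] an index is picked from a set of
     [U] on which the energy distance is small enough. *)
  have /choice[k kP] (n : nat) : exists k : nat, forall B,
      \sum_(x <- B) energy (fun y => v k y - u y) x * mu x
        <= Num.min 1 h0 * n.+1%:R^-1 `^ p.
    have /(energy_cauchy _ ooU vmin vu) : 0 < Num.min 1 h0 * n.+1%:R^-1 `^ p.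
      by rewrite mulr_gt0// powR_gt0// invr_gt0.
    by move=> /filter_ex[k kP]; exists k.
  exists (fun n => v (k n)); split=> [n|]; first exact: covered_finite (vmin _).1.
  exact: cvg_W1p_norm_energy.
(* A Fatou argument: the uniform energy bound passes to the limit on every finite set. *)
- apply: le_lt_trans (ltry C); apply: integralV_le => B.
  have : (fun n => \sum_(x <- B) energy (v n) x * mu x) @ U
      --> \sum_(x <- B) energy u x * mu x.
    by apply: cvg_fsum => x; apply: cvgMl; exact: cvg_energy.
  move=> /cvgr_to_le; move=> /(_ C) /= le.
  apply: (@le_trans _ _ (\sum_(x <- B) energy u x * mu x)); last first.
    by apply: le; apply: (@filterS _ U _ setT _ _ filterT) => n _; exact: vE.
  apply: ler_sum => x _; rewrite ler_wpM2r ?(ltW (mu_gt0 x))// energyE//.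
  by rewrite lerDr powR_ge0.
- move=> x t; set N := (x |` nbs G x)%fset.
  pose pert w z := w z + t * point_mass x z.
  (* The added [n.+1%:R^-1] compensates for [v n] being only an approximate minimizer, and vanishes
     in the limit. *)
  have lim : (fun n => \sum_(y <- N) (lagrangian (pert (v n)) y - lagrangian (v n) y)
      + n.+1%:R^-1) @ U
      --> \sum_(y <- N) (lagrangian (pert u) y - lagrangian u y) + 0.
    apply: cvgD; last exact: cvg_trans (cvg_app _ ooU) (@cvg_harmonic R).
    apply: cvg_fsum => y; apply: cvgB; apply: cvg_lagrangian => // z.
    by apply: cvgD; [exact: vu|exact: cvg_cst].
  rewrite -[leRHS]addr0; apply: (cvgr_to_ge lim).
  apply: (@filterS _ U _ setT _ _ filterT) => n _.
  pose B := (A n `|` N)%fset.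
  have Bv : covered B (v n) by apply: coveredS (vmin n).1; exact: fsubsetUl.
  have Bp : covered B (pert (v n)).
    rewrite (_ : pert _ = (fun z => 1 * v n z + t * point_mass x z)).
      apply: covered_lin => //; apply: coveredS (@covered_point_mass R V G x).
      exact: fsubsetUr.
    by apply/funext => z; rewrite mul1r.
  (* Off [N] the perturbation changes neither the value nor any neighboring value, so the sum
     extends to [B], where it is a difference of two actions. *)
  rewrite (@fsum_eq0_sub _ _ _ N B) ?fsubsetUr//; last first.
    move=> y; rewrite in_fset1U negb_or in_nbs => /andP[yx xy].
    have bz z : adj G y z -> point_mass x z = 0 :> R.
      rewrite /point_mass; case: eqP => // -> yx'.
      by move: xy; rewrite (adj_sym G) yx'.
    have pz w z : point_mass x z = 0 :> R -> pert w z = w z.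
      by rewrite /pert => ->; rewrite mulr0 addr0.
    have by0 : point_mass x y = 0 :> R by rewrite /point_mass (negbTE yx).
    apply/eqP; rewrite subr_eq0; apply/eqP.
    rewrite /lagrangian /energy /grad2 /grad_inner (pz _ y)//.
    congr ((((_ * _) `^ _ + _) / _ - _) * _).
    rewrite big_seq [RHS]big_seq; apply: eq_bigr => z; rewrite in_nbs => yz.
    by rewrite (pz _ z) ?bz.
  have combine (i r a b : R) : b <= i + r -> i <= a -> 0 <= a - b + r by lra.
  rewrite sumrB; apply: (combine _ _ _ _ _ (inf_action_le Bp)).
  by rewrite -(action_covered (vmin n).1 Bv) (vmin n).2.
Qed.

End minimization.

(** * The Euler-Lagrange equation *)

Section euler_lagrange.
Context {R : realType} {V : choiceType}.
Variables (G : wgraph R V) (mu h : V -> R) (p : R) (W : V -> R -> R).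
Hypothesis mu_gt0 : forall x, 0 < mu x.
Hypothesis h_ge0 : forall x, 0 <= h x.
Hypothesis p_ge2 : 2 <= p.
Implicit Types (u d : V -> R) (x y : V).

Lemma fsum_point_mass (A : {fset V}) (f : V -> R) x :
  \sum_(y <- A) point_mass x y * f y = (x \in A)%:R * f x.
Proof.
have [xA|xA] := boolP (x \in A).
  rewrite (big_fsetD1 x)//= big_seq big1 ?addr0 => [|y].
    by rewrite /point_mass eqxx.
  by rewrite in_fsetD1 => /andP[yx _]; rewrite /point_mass (negbTE yx) mul0r.
rewrite mul0r big_seq big1// => y yA.
rewrite /point_mass; case: eqP => [yx|_]; last by rewrite mul0r.
by rewrite -yx yA in xA.
Qed.

(** Summation by parts against a point mass. An edge [xy] contributes once from [x] and once from
    [y], each with the gradient weight of its own vertex, which produces the sum of two weights in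
    the [p]-Laplacian. *)
Lemma plaplacian_point_mass u x :
  \sum_(y <- (x |` nbs G x)%fset)
    grad G mu u y `^ (p - 2) * grad_inner G mu u (point_mass x) y * mu y
  = - (mu x * plaplacian G mu p u x).
Proof.
set g := fun y => grad G mu u y `^ (p - 2).
have inner y : grad_inner G mu u (point_mass x) y * mu y =
    2^-1 * ((adj G y x)%:R * (wt G y x * (u x - u y)))
    - point_mass x y * (2^-1 * \sum_(z <- nbs G y) wt G y z * (u z - u y)).
  rewrite -in_nbs -(fsum_point_mass _ (fun z => wt G y z * (u z - u y))).
  rewrite mulrCA -mulrBr mulr_sumr -sumrB /grad_inner.
  rewrite mulrAC invfM -[_ * _ * mu y]mulrA mulVf ?gt_eqF// mulr1; congr (_ * _).
  by apply: eq_bigr => z _; ring.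
under eq_bigr => y _.
  rewrite -mulrA inner mulrBr mulrCA [X in _ - X]mulrCA.
  over.
rewrite sumrB fsum_point_mass fset1U1 mul1r -mulr_sumr.
have half : mu x * (2 * mu x)^-1 = 2^-1 by field; rewrite gt_eqF.
rewrite /plaplacian [X in _ = - X]mulrA half.
rewrite fsbig_finite; last exact: locally_finite.
rewrite -/(nbs G x) -[in RHS]/g.
have -> : \sum_(y <- (x |` nbs G x)%fset)
      g y * ((adj G y x)%:R * (wt G y x * (u x - u y)))
    = \sum_(y <- nbs G x) g y * (wt G x y * (u x - u y)).
  rewrite -(big_fset_incl _ (fsubsetU1 _ _))/=; last first.
    by move=> y _; rewrite in_nbs (adj_sym G) => /negbTE ->; rewrite mul0r mulr0.
  rewrite big_seq [RHS]big_seq; apply: eq_bigr => y; rewrite in_nbs => xy.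
  by rewrite (adj_sym G) xy mul1r (wt_sym xy).
rewrite [X in _ - X]mulrCA -mulrBr -[RHS]mulrN; congr (_ * _).
rewrite mulr_sumr -sumrB -sumrN; apply: eq_bigr => y _.
by rewrite /g; ring.
Qed.

(* The convexity inequality [powR_tangent] bounds the increments of the action
   by continuous expressions, which avoids differentiating [r `^ (p / 2)] at 0. *)
Lemma euler_lagrange u x : derivable (W x) (u x) 1 ->
  (forall t : R, 0 <= \sum_(y <- (x |` nbs G x)%fset)
    (lagrangian G mu h p W (fun z => u z + t * point_mass x z) y
     - lagrangian G mu h p W u y)) ->
  - plaplacian G mu p u x + h x * `|u x| `^ (p - 2) * u x = derive1 (W x) (u x).
Proof.
move=> dW umin; have p0 : 0 < p by apply: lt_le_trans p_ge2.
have q1 := half_p_ge1 p_ge2.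
pose d : V -> R := point_mass x; pose q := p / 2.
pose pert t z := u z + t * d z.
(* The tangent is taken at the perturbed point, so [t * phi t y] bounds the increment from above,
   and [phi t y] tends to [dphi y] as [t] tends to 0. *)
pose phi t y := (2^-1 * grad2 G mu (pert t) y `^ (q - 1)
      * (2 * grad_inner G mu u d y + t * grad2 G mu d y)
    + 2^-1 * h y * (pert t y ^+ 2) `^ (q - 1) * (2 * (u y * d y) + t * d y ^+ 2)
    - d y * ((W x (u x + t) - W x (u x)) / t)) * mu y.
pose dphi y := (2^-1 * grad2 G mu u y `^ (q - 1) * (2 * grad_inner G mu u d y)
    + 2^-1 * h y * (u y ^+ 2) `^ (q - 1) * (2 * (u y * d y))
    - d y * derive1 (W x) (u x)) * mu y.
have phi_ge t y : lagrangian G mu h p W (pert t) y - lagrangian G mu h p W u y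
    <= t * phi t y.
  rewrite /lagrangian -mulrBl mulrA ler_wpM2r ?(ltW (mu_gt0 y))//.
  (* Using [W x] at every [y] is harmless: its factor [d y] vanishes unless [y = x]. *)
  have Wt : W y (pert t y) - W y (u y) = t * (d y * ((W x (u x + t) - W x (u x)) / t)).
    rewrite /pert /d /point_mass; case: eqP => [->|_]; last first.
      by rewrite mulr0 addr0 subrr !mul0r mulr0.
    rewrite mul1r mulr1; have [->|t0] := eqVneq t 0; first by rewrite addr0 subrr mul0r.
    by rewrite mulrCA divff// mulr1.
  have := powR_tangent q1 (grad2_ge0 G mu_gt0 (pert t) y) (grad2_ge0 G mu_gt0 u y).
  have -> : grad2 G mu (pert t) y - grad2 G mu u y
      = t * (2 * grad_inner G mu u d y + t * grad2 G mu d y).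
    by rewrite grad2D addrAC subrr add0r.
  move=> /(ler_wpM2r (ltW (_ : 0 < p^-1))); rewrite invr_gt0 => /(_ p0).
  have := powR_tangent q1 (sqr_ge0 (pert t y)) (sqr_ge0 (u y)).
  move=> /(ler_wpM2l (h_ge0 y)) /(ler_wpM2r (ltW (_ : 0 < p^-1))).
  rewrite invr_gt0 => /(_ p0).
  have half (a b : R) : p / 2 * a * b / p = 2^-1 * a * b by field; rewrite gt_eqF.
  rewrite -mulrA -[X in _ <= X -> _]mulrA half -/q.
  have -> : pert t y ^+ 2 - u y ^+ 2 = t * (2 * (u y * d y) + t * d y ^+ 2).
    by rewrite /pert; ring.
  move=> h_le; rewrite half -/q => g_le.
  move: Wt g_le h_le; rewrite /phi /energy -/q.
  move: (W y _) (W y _) (W x _ - W x _) => Wp Wu dWx.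
  move: (_ `^ q) (_ `^ q) (_ `^ q) (_ `^ q) (_ `^ (q - 1)) (_ `^ (q - 1)) (dWx / t).
  move=> a b c k r s w Wt h1 h2.
  rewrite -subr_ge0; move: h1 h2; rewrite -subr_ge0.
  rewrite -[X in _ -> is_true X -> _]subr_ge0 => h1 h2.
  have := addr_ge0 h1 h2; rewrite (_ : Wu = Wp + t * (d y * w)); last first.
    by rewrite -Wt addrC subrK.
  by congr (_ <= _); ring.
have phi_cvg : (fun t => \sum_(y <- (x |` nbs G x)%fset) phi t y) @ 0^'
    --> \sum_(y <- (x |` nbs G x)%fset) dphi y.
  have id0 : (fun t : R => t) @ 0^' --> (0 : R) by exact: cvg_within.
  have pert_cvg y : pert ^~ y @ 0^' --> u y.
    rewrite -[X in _ --> X]addr0 -[X in _ + X](mul0r (d y)).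
    by apply: cvgD; [exact: cvg_cst|exact: cvgMl].
  have slope (a b : R) : (fun t => a + t * b) @ 0^' --> a.
    rewrite -[X in _ --> X]addr0 -[X in _ + X](mul0r b).
    by apply: cvgD; [exact: cvg_cst|exact: cvgMl].
  have q10 : 0 <= q - 1 by rewrite subr_ge0.
  apply: cvg_fsum => y; apply: cvgMl; apply: cvgB; last first.
    by apply: cvgMr; exact: derivable_slope_cvg.
  apply: cvgD; apply: cvgM => //; apply: cvgMr; apply: cvg_powR => //.
  - by move=> t; exact: grad2_ge0.
  - exact: grad2_ge0.
  - exact: cvg_grad2.
  - by move=> t; exact: sqr_ge0.
  - exact: sqr_ge0.
  - by under eq_fun do rewrite expr2; apply: cvgM.
(* By minimality [t] times the sum of [phi t] is nonnegative for either sign of [t]. *)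
have : \sum_(y <- (x |` nbs G x)%fset) dphi y = 0.
  apply: dnbhs_sign_cvg_eq0 phi_cvg => t; apply: le_trans (umin t) _.
  by rewrite mulr_sumr; apply: ler_sum => y _; exact: phi_ge.
have -> : \sum_(y <- (x |` nbs G x)%fset) dphi y =
    - (mu x * plaplacian G mu p u x)
    + (h x * `|u x| `^ (p - 2) * u x - derive1 (W x) (u x)) * mu x.
  have q2 : (p - 2) / 2 = q - 1 by rewrite /q; field.
  have := fsum_point_mass (x |` nbs G x)%fset
    (fun y => (h y * `|u y| `^ (p - 2) * u y - derive1 (W x) (u x)) * mu y) x.
  rewrite fset1U1 mul1r => <-; rewrite -plaplacian_point_mass.
  rewrite -big_split/=; apply: eq_bigr => y _.
  by rewrite grad_powR// norm_powR_sqr q2 /dphi -/d; field.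
rewrite addrC mulrC -mulrBr => /eqP; rewrite mulf_eq0 gt_eqF//= => /eqP L.
by apply/eqP; rewrite -subr_eq0 -L; apply/eqP; ring.
Qed.

End euler_lagrange.

(** * The potential F(x, s) + eps e(x) s *)

(** The lower bound gives the difference quotient at 0 the sign of [t], up to a correction of order
    [beta - 1 > 0] that disappears in the limit. *)
Lemma derive1_eq0_of_ge_powR (R : realType) (f : R -> R) (K beta : R) :
  1 < beta -> derivable f 0 1 -> f 0 = 0 ->
  (forall s, - K * `|s| `^ beta <= f s) -> derive1 f 0 = 0.
Proof.
move=> b1 df f0 fK; have b10 : 0 < beta - 1 by rewrite subr_gt0.
pose phi t := (f (0 + t) - f 0) / t + K * (`|t| `^ (beta - 1) * Num.sg t).
apply: (@dnbhs_sign_cvg_eq0 _ phi) => [t|].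
  have [->|t0] := eqVneq t 0; first by rewrite mul0r.
  rewrite /phi f0 add0r subr0 mulrDr mulrCA divff// mulr1.
  have -> : t * (K * (`|t| `^ (beta - 1) * Num.sg t)) = K * `|t| `^ beta.
    rewrite -(@mulr_powRB1 _ `|t| beta)//; last exact: lt_trans b1.
    by rewrite {2}normrEsg; ring.
  by have := fK t; lra.
rewrite -[X in _ --> X]addr0 -[X in _ + X](mulr0 K).
apply: cvgD; first exact: derivable_slope_cvg.
apply: cvgMr; apply/norm_cvg0P.
have lim : (fun t : R => `|t| `^ (beta - 1)) @ 0^' --> (0 : R).
  rewrite -[X in _ --> X](@powR0 _ (beta - 1)) ?gt_eqF//.
  apply: cvg_powR => //; first exact: ltW.
  by apply/norm_cvg0P; exact: cvg_within.
apply: squeeze_cvgr (@cvg_cst _ _ _ _ _) lim; near=> t.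
rewrite normr_ge0/= normrM ger0_norm ?powR_ge0// normr_sg.
by rewrite ler_piMr ?powR_ge0// lern1 leq_b1.
Unshelve. all: end_near. Qed.

Lemma supnormV_lt (R : realType) (V : choiceType) (f : V -> R) (c : R) :
  0 < c -> (supnormV f < c%:E)%E ->
  exists M, [/\ 0 <= M, M < c & forall x, `|f x| <= M].
Proof.
move=> c0 fc; have le x : (`|f x|%:E <= supnormV f)%E.
  by apply: ereal_sup_ubound; exists x.
case: (supnormV f) fc le => [s|//|] sc le.
  exists (Num.max 0 s); split=> [||x]; first by rewrite le_max lexx.
    by rewrite gt_max c0.
  by have := le x; rewrite lee_fin le_max => ->; rewrite orbT.
(* The supremum is -oo only when there is no vertex. *)
by exists 0; split=> // x; have := le x; rewrite leeNy_eq.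
Qed.

Section perturbed_potential.
Context {R : realType} {V : choiceType}.
Variables (mu : V -> R) (p : R) (F : V -> R -> R) (e : V -> R) (eps : R).
Hypotheses (p_ge2 : 2 <= p) (eps_gt0 : 0 < eps).
Hypothesis F_derivable : forall x (s : R), derivable (F x) s 1.
Hypothesis F0 : forall x, F x 0 = 0.

Definition potential x s := F x s + eps * e x * s.

Lemma is_derive_potential x (s : R) :
  is_derive s 1 (potential x) (derive1 (F x) s + eps * e x).
Proof.
have : is_derive s 1 (F x) (derive1 (F x) s).
  by rewrite derive1E; exact/derivableP.
move=> dF; apply: is_derive_eq.
by rewrite /GRing.scale/= mulr1.
Qed.

Lemma continuous_potential x : continuous (potential x).
Proof.
move=> s; suff : {for s, continuous (potential x)} by [].
apply/differentiable_continuous/derivable1_diffP.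
by have [] := is_derive_potential x s.
Qed.

(** Integrating (f1) costs [M / p] of the available [h0 / p]. Young's inequality absorbs the terms
    in [g1] and [e] into part of the remaining gap. *)
Lemma potential_growth (h f1 g1 : V -> R) (h0 M : R) :
  0 <= M -> M < h0 -> (forall x, h0 <= h x) -> (forall x, f1 x <= M) ->
  (forall x, 0 <= g1 x) ->
  (forall x s, `|derive1 (F x) s| <= f1 x * `|s| `^ (p - 1) + g1 x) ->
  exists theta C1 C2 : R, [/\ 0 < theta, theta <= p^-1, 0 <= C1 & 0 <= C2] /\
    forall x s, potential x s <= (p^-1 - theta) * (h x * (s ^+ 2) `^ (p / 2))
      + (C1 * `|g1 x| `^ (p / (p - 1)) + C2 * `|e x| `^ (p / (p - 1))).
Proof.
move=> M0 Mh hh f1M g10 F'le.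
have p1 : 1 < p by rewrite (lt_le_trans _ p_ge2)// ltr1n.
have p0 : 0 < p by lra.
have h0_gt0 : 0 < h0 by lra.
pose k := 1 - M / h0.
have k0 : 0 < k by rewrite subr_gt0 ltr_pdivrMr// mul1r.
have k1 : k <= 1 by rewrite gerBl divr_ge0// ltW.
(* The gap [(h0 - M) / p] equals [k * h0 / p]: half of it is kept as [theta * h0], and each Young
   term receives a quarter, [d]. *)
pose theta := k / (2 * p); pose d := k * h0 / (4 * p).
have d0 : 0 < d by rewrite divr_gt0 ?mulr_gt0.
have [C1 C10 C1P] := young_powR_eps p1 d0.
have de0 : 0 < d / eps by rewrite divr_gt0.
have [C2 C20 C2P] := young_powR_eps p1 de0.
have theta_le : theta <= p^-1.
  rewrite /theta ler_pdivrMr ?mulr_gt0// mulrCA mulVf ?gt_eqF// mulr1; lra.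
exists theta, C1, (eps * C2); split.
  by split=> //; [rewrite divr_gt0 ?mulr_gt0|rewrite mulr_ge0// ltW].
move=> x s; rewrite -norm_powR_sqr.
have Fle := derive1_growth p1 (@F_derivable x) (F0 x) (F'le x) s.
have s0 := powR_ge0 `|s| p.
have g1s : g1 x * `|s| <= d * `|s| `^ p + C1 * `|g1 x| `^ (p / (p - 1)).
  rewrite mulrC -{1}(ger0_norm (g10 x)); exact: C1P.
have e_young : eps * (`|s| * `|e x|)
    <= d * `|s| `^ p + eps * C2 * `|e x| `^ (p / (p - 1)).
  have := ler_wpM2l (ltW eps_gt0) (C2P _ _ (normr_ge0 s) (normr_ge0 (e x))).
  move/le_trans; apply; rewrite le_eqVlt; apply/orP; left; apply/eqP.
  by field; rewrite gt_eqF.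
have es : eps * e x * s <= eps * (`|s| * `|e x|).
  by rewrite -mulrA ler_wpM2l ?(ltW eps_gt0)// mulrC -normrM ler_norm.
have f1s : f1 x / p * `|s| `^ p <= M / p * `|s| `^ p.
  by rewrite ler_wpM2r// ler_wpM2r ?invr_ge0 ?(ltW p0).
have hs : M / p * `|s| `^ p + 2 * (d * `|s| `^ p)
    <= (p^-1 - theta) * (h x * `|s| `^ p).
  apply: (@le_trans _ _ ((p^-1 - theta) * (h0 * `|s| `^ p))).
    rewrite le_eqVlt; apply/orP; left; apply/eqP.
    by rewrite /theta /d /k; field; rewrite !gt_eqF.
  by rewrite ler_wpM2l ?subr_ge0// ler_wpM2r.
have combine (Fs A B Gs T D Y1 Y2 Es E : R) : Fs <= A + Gs -> A <= B ->
    Gs <= D + Y1 -> Es <= E -> E <= D + Y2 -> B + 2 * D <= T ->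
    Fs + Es <= T + (Y1 + Y2) by lra.
exact: combine Fle f1s g1s es e_young hs.
Qed.

(** The linear term [eps * e x * s] cancels in the defect. The three values of [F] have weights 1/2,
    1/2 and 1, hence the factor 2 before the maximum of [a] on the bounded range. *)
Lemma potential_midpoint (a : R -> R) (b : V -> R) :
  {within `[0, +oo[, continuous a} -> (forall t, 0 <= t -> 0 <= a t) ->
  (forall x, 0 <= b x) -> in_LV mu 1 b ->
  (forall x s, `|F x s| <= a `|s| * b x) ->
  forall C : R, exists b' : V -> R,
  [/\ (forall x, 0 <= b' x),
      (exists Cb : R, forall A : {fset V}, \sum_(x <- A) b' x * mu x <= Cb)
    & (forall x (s t : R), `|s| <= C -> `|t| <= C ->
        (potential x s + potential x t) / 2 - potential x ((s + t) / 2) <= b' x)].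
Proof.
move=> ca a0 b0 bL Fb C.
have ca' : {within `[0, `|C|], continuous a}.
  by apply: continuous_subspaceW ca; apply: subset_itvl; rewrite bnd_simp.
have [c c0C cmax] := EVT_max (normr_ge0 C) ca'.
have c0 : 0 <= c by move: c0C; rewrite in_itv/= => /andP[].
have [Cb bCb] := in_LV_bounded ltr01 bL.
exists (fun x => 2 * a c * b x); split=> [x||x s t sC tC].
- by rewrite !mulr_ge0// a0.
- exists (2 * a c * Cb) => A.
  rewrite (eq_bigr (fun x => 2 * a c * (`|b x| `^ 1 * mu x))) => [|x _].
    by rewrite -mulr_sumr ler_wpM2l// mulr_ge0// a0.
  by rewrite powRr1// ger0_norm// mulrA.
- have Fc r : `|r| <= C -> `|F x r| <= a c * b x.
    move=> rC; apply: le_trans (Fb x r) _; rewrite ler_wpM2r// cmax// in_itv/=.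
    by rewrite normr_ge0 (le_trans rC)// ler_norm.
  have mC : `|(s + t) / 2| <= C.
    rewrite normrM (@ger0_norm _ 2^-1)// ler_pdivrMr//.
    by rewrite (le_trans (ler_normD _ _))//; lra.
  have := Fc _ sC; have := Fc _ tC; have := Fc _ mC.
  by rewrite /potential !ler_norml; lra.
Qed.

End perturbed_potential.

Theorem theorem1p4 (R : realType) (V : choiceType) (G : wgraph R V)
  (mu : V -> R) (mu0 : R) (mu0_gt0 : 0 < mu0) (mu_ge : forall x, mu0 <= mu x)
  (p : R) (p_ge2 : 2 <= p)
  (h : V -> R) (F : V -> R -> R) (e : V -> R)
  (e_Lq : in_LV mu (p / (p - 1)) e) (e_neq0 : exists x, e x != 0)
  (h0 : R) (h0_gt0 : 0 < h0) (h1 : forall x, h0 <= h x)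
  (h2 : exists x0 : V, forall M : R, exists N : nat,
     forall x, (N <= dist G x x0)%N -> M <= h x)
  (f0 : (forall x, (forall s : R, derivable (F x) s 1) /\ continuous (derive1 (F x))) /\
     exists (a : R -> R) (b : V -> R),
       [/\ {within `[0, +oo[, continuous a} /\ (forall t, 0 <= t -> 0 <= a t),
           (forall x, 0 <= b x) /\ in_LV mu 1 b,
           (forall x s, `|derive1 (F x) s| <= a `|s| * b x)
         & (forall x s, `|F x s| <= a `|s| * b x)])
  (f1 : (forall x, F x 0 = 0) /\
     exists f1 g1 : V -> R,
       [/\ (forall x, 0 <= f1 x) /\ (forall x, 0 <= g1 x),
           in_LinftyV f1 /\ (supnormV f1 < h0%:E)%E,
           in_LV mu (p / (p - 1)) g1
         & (forall x s, `|derive1 (F x) s| <= f1 x * `|s| `^ (p - 1) + g1 x)])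
  (f2 : exists (beta1 : R) (K1 : V -> R),
       [/\ 1 < beta1,
           (exists x1, 0 < K1 x1 /\ 0 < e x1)
         & (forall x s, - K1 x * `|s| `^ beta1 <= F x s)])
  (eps : R) (eps_gt0 : 0 < eps) :
  exists u : V -> R,
    [/\ W1ph G mu h p u,
        (forall x, - plaplacian G mu p u x + h x * `|u x| `^ (p - 2) * u x
                   = derive1 (F x) (u x) + eps * e x)
      & (exists x, u x != 0)].
Proof.
have mu_gt0 x : 0 < mu x by exact: lt_le_trans (mu_ge x).
have h_ge0 x : 0 <= h x by rewrite (le_trans (ltW h0_gt0)).
have p0 : 0 < p by lra.
have r0 : 0 < p / (p - 1) by rewrite divr_gt0//; lra.
case: f0 => F_diff [a [b [[ca a0] [b0 bL] _ Fb]]].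
have F_derivable x s : derivable (F x) s 1 by case: (F_diff x) => + _; exact.
case: f1 => F0 [f [g1 [[f0 g10] [_ fh] g1L F'le]]].
have [M [M0 Mh fM]] := supnormV_lt h0_gt0 fh.
have fM' x : f x <= M by rewrite (le_trans (ler_norm _)).
have [theta [C1 [C2 [[th0 thp C10 C20] growth]]]] :=
  potential_growth e p_ge2 eps_gt0 F_derivable F0 M0 Mh h1 fM' g10 F'le.
have [Cg g1C] := in_LV_bounded r0 g1L.
have [Ce eC] := in_LV_bounded r0 e_Lq.
(* The remainder of the growth bound is summable because [g1] and [e] both lie in the Lebesgue space
   of exponent [p / (p - 1)]. *)
have g_sum (A : {fset V}) : \sum_(x <- A) (C1 * `|g1 x| `^ (p / (p - 1))
    + C2 * `|e x| `^ (p / (p - 1))) * mu x <= C1 * Cg + C2 * Ce.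
  under eq_bigr do rewrite mulrDl -!mulrA.
  by rewrite big_split/= -!mulr_sumr lerD// ler_wpM2l.
have W0 x : potential F e eps x 0 = 0 by rewrite /potential F0 mulr0 addr0.
have [u [uW umin]] := local_minimizer G mu0_gt0 mu_ge h0_gt0 h1 p_ge2 W0
  (continuous_potential F_derivable) th0 thp g_sum growth
  (@potential_midpoint R V mu F e eps a b ca a0 b0 bL Fb).
have EL x : - plaplacian G mu p u x + h x * `|u x| `^ (p - 2) * u x
    = derive1 (F x) (u x) + eps * e x.
  have [dW dWE] := @is_derive_potential R V F e eps F_derivable x (u x).
  by rewrite (euler_lagrange mu_gt0 h_ge0 p_ge2 dW (umin x)) derive1E.
(* If [u] vanished, the equation at [x1] would reduce to [0 = eps * e x1], since (f2) makes the
   derivative of [F x1] at 0 vanish. *)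
exists u; split=> //; apply: contrapT => /forallNP u0.
have {}u0 x : u x = 0 by have /negP/negPn/eqP := u0 x.
have [beta1 [K1 [beta1_gt1 [x1 [_ ex1]] FK]]] := f2.
have := EL x1; rewrite u0 mulr0 addr0 /plaplacian fsbig_finite; last first.
  exact: locally_finite.
rewrite big1 => [|y _]; last by rewrite !u0 subrr mulr0.
rewrite mulr0 oppr0 (@derive1_eq0_of_ge_powR _ _ (K1 x1) beta1)// add0r.
by move=> /esym/eqP; rewrite gt_eqF// mulr_gt0.
Qed.
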